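(* Let $(X,T)$ be a topological space. Then: (i) $(X,T)$ is a $T_0$-space iff for any $x,y\in X$: $x=y\Leftrightarrow\mu(x)=\mu(y)$. (ii) $(X,T)$ is a $T_1$-space iff for any $x,y\in X$: $x=y\Leftrightarrow\mu(x)$ and $\mu(y)$ are comparable.
   Context: Nonstandard setting. Let $S\supseteq X\cup\mathbb R$ be a set of individuals, with superstructure $V(S)=\bigcup_{k\ge 0}V_k(S)$, $V_0(S)=S$, $V_{k+1}(S)=V_k(S)\cup\mathcal P(V_k(S))$. A $\kappa$-saturated nonstandard model of $S$ is a superstructure $V({}^*S)$ with a map $A\mapsto {}^*A$ from $V(S)$ into $V({}^*S)$ satisfying: (Extension) ${}^*s=s$ for all $s\in S$; (Transfer) a bounded quantifier formula $\Phi(A_1,\dots,A_n)$ with constants in $V(S)$ is true iff $\Phi({}^*A_1,\dots,{}^*A_n)$ is true in $V({}^*S)$; (Saturation) every family of at most $\kappa$ internal sets with the finite intersection property has nonempty intersection. An entity of $V({}^*S)$ is internal if it is an element of ${}^*A$ for some $A\in V(S)$. Throughout, a $\kappa$-saturated model with $\kappa$ infinite and $\kappa>\operatorname{card}T$ is fixed; $X\subseteq {}^*X$. Monads: for $\alpha\in{}^*X$, $\mu(\alpha)=\bigcap\{{}^*G:G\in T,\ \alpha\in{}^*G\}$. Two sets $A,B$ are comparable if $A\subseteq B$ or $A\supseteq B$. *)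

(* Defs.v *)
From HB Require Import structures.
From mathcomp Require Import all_boot.
From mathcomp Require Import all_classical reals.
From mathcomp Require Import topology.

Set Implicit Arguments.
Unset Strict Implicit.
Unset Printing Implicit Defensive.

Local Open Scope classical_set_scope.
Local Open Scope card_scope.

Section Superstructure.
Variable S : Type.

(* Since V_k is included in V_(k+1), an element of
   V_(k+1) = V_k U P(V_k) is either an individual or a subset of V_k. *)
Fixpoint level (k : nat) : Type :=
  if k is k'.+1 then (S + set (level k'))%type else S.

(* The inclusion of V_k in V_(k+1). *)
Fixpoint raise (k : nat) : level k -> level k.+1 :=
  match k return level k -> level k.+1 with
  | 0 => fun s => inl s
  | k'.+1 => fun x => match x with
                      | inl s => inl s
                      | inr A => inr (raise (k := k') @` A)
                      end
  end.

Definition code := {k : nat & level k}.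

Definition raise_code (c : code) : code := Tagged level (raise (tagged c)).

(* Two codes denote the same entity when they agree at some common level. *)
Definition same_entity (c d : code) : Prop :=
  exists m n : nat, iter m raise_code c = iter n raise_code d.

(* V(S), the union of the V_k(S): codes modulo same_entity. An element of V(S)
   is the class of all its codes, so that equality is Leibniz equality. *)
Definition superstructure : Type :=
  {C : set code | exists c, C = same_entity c}.

Definition entity (c : code) : superstructure :=
  exist _ (same_entity c) (ex_intro _ c erefl).

Definition ind (s : S) : superstructure := entity (@Tagged nat 0 level s).

Definition setv (k : nat) (A : set (level k)) : superstructure :=
  entity (@Tagged nat k.+1 level (inr A)).

(* Individuals have no elements. *)
Definition memv (x y : superstructure) : Prop :=
  exists (k : nat) (a : level k) (A : set (level k)),
    [/\ x = entity (Tagged level a), y = setv A & A a].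

Definition is_set (x : superstructure) : Prop :=
  exists (k : nat) (A : set (level k)), x = setv A.

Definition elements (x : superstructure) : set superstructure :=
  [set y | memv y x].

(* A set of individuals, as an element of V_1. *)
Definition set_of_ind (A : set S) : superstructure := @setv 0 A.

(* V_k(S) as a subset of V(S). The lemmas stage0 and stageS below are its
   defining equations, with P(V_k) described as the sets whose elements lie
   in V_k; elements_inj is extensionality. *)
Definition stage (k : nat) : set superstructure :=
  [set x | exists a : level k, x = entity (Tagged level a)].

Lemma raise_inj k : injective (@raise k).
Proof.
elim: k => [|k IH] /=; first by move=> s t [].
move=> [s|A] [t|B] //= [].
  by move=> ->.
move=> AB; congr inr; apply/predeqP => x.
by rewrite -(image_inj IH) AB (image_inj IH).
Qed.

Lemma raise_code_inj : injective raise_code.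
Proof.
move=> [k a] [l b]; rewrite /raise_code /= => e.
have kl : k = l by case: (congr1 tag e).
subst l; congr (existT _ _ _); apply: raise_inj.
exact: (existT_inj2 e).
Qed.

Lemma entity_eq c d : entity c = entity d <-> same_entity c d.
Proof.
split=> [[] cd|[m [n cd]]].
  by rewrite cd; exists 0, 0.
apply: eq_exist; apply/predeqP => x; split=> -[p [q e]].
  by exists (p + n), (m + q); rewrite iterD -cd -iterD addnC iterD e -iterD.
by exists (p + m), (n + q); rewrite iterD cd -iterD addnC iterD e -iterD.
Qed.

Lemma entity_inj k : injective (fun a : level k => entity (Tagged level a)).
Proof.
move=> a b /entity_eq[m [n e]].
have tagup p (c : code) : tag (iter p raise_code c) = p + tag c.
  by elim: p => //= p ->.
have /eqP := congr1 tag e; rewrite !tagup /= eqn_add2r => /eqP mn; subst n.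
have {}e : Tagged level a = Tagged level b.
  by elim: m e => //= m IH /raise_code_inj.
exact: existT_inj2 e.
Qed.

Lemma entity_raise k (a : level k) :
  entity (Tagged level (raise a)) = entity (Tagged level a).
Proof. by apply/entity_eq; exists 0, 1. Qed.

Lemma setv_raise k (A : set (level k)) : setv (@raise k @` A) = setv A.
Proof. exact: (@entity_raise k.+1 (inr A)). Qed.

Definition entities (k : nat) (A : set (level k)) : set superstructure :=
  (fun a => entity (Tagged level a)) @` A.

Lemma setv_entities k l (A : set (level k)) (B : set (level l)) :
  setv A = setv B <-> entities A = entities B.
Proof.
have step m j (C : set (level j)) : exists C' : set (level (m + j)),
    setv C' = setv C /\ entities C' = entities C.
  elim: m => [|m [C' [<- <-]]]; first by exists C.
  exists (@raise (m + j) @` C'); split; first exact: setv_raise.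
  rewrite /entities image_comp; congr (_ @` _); apply/funext => x /=.
  exact: entity_raise.
have [A' [<- <-]] := step l k A.
have [B' [<- <-]] := step k l B.
move: A' B'; rewrite addnC => A' B' {step}; split=> [|AB].
  by move=> /(@entity_inj (k + l).+1 (inr A') (inr B'))[->].
have E (C : set (level (k + l))) x :
  entities C (entity (Tagged level x)) = C x := image_inj (@entity_inj _).
by congr setv; apply/predeqP => x; rewrite -!E AB.
Qed.

Lemma elements_setv k (A : set (level k)) : elements (setv A) = entities A.
Proof.
apply/seteqP; split=> [x [l [b [B [-> AB Bb]]]]|x [a Aa <-]].
  by move/setv_entities: AB => ->; exists b.
by exists k, a, A.
Qed.

Lemma memv_ind x s : ~ memv x (ind s).
Proof.
move=> [k [a [A [_ sA _]]]].
have indk j : ind s = entity (@Tagged nat j.+1 level (inl s)).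
  elim: j => [|j ->]; first exact/esym/(@entity_raise 0 s).
  exact/esym/(@entity_raise j.+1 (inl s)).
by have := @entity_inj k.+1 (inl s) (inr A); rewrite -indk => /(_ sA).
Qed.

Lemma ind_inj : injective ind.
Proof. exact: (@entity_inj 0). Qed.

Lemma elements_inj x y :
  is_set x -> is_set y -> elements x = elements y -> x = y.
Proof.
by move=> [k [A ->]] [l [B ->]]; rewrite !elements_setv => /setv_entities.
Qed.

Lemma stage0 : stage 0 = range ind.
Proof. by apply/seteqP; split=> x [a]; [move=> ->|move=> _ <-]; exists a. Qed.

Lemma stageS k :
  stage k.+1 = stage k `|` [set x | is_set x /\ elements x `<=` stage k].
Proof.
have sub : stage k `<=` stage k.+1.
  by move=> _ [a ->]; exists (raise a); rewrite entity_raise.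
apply/seteqP; split=> [x [a ->]|x [/sub//|[[l [A ->]] Ak]]].
  case: a => [s|A]; [left|right].
    case: k sub => [|k] _; first by exists s; exact: (@entity_raise 0 s).
    by exists (inl s); exact: (@entity_raise k.+1 (inl s)).
  split; first by exists k, A.
  by rewrite -/(setv A) elements_setv => y [a Aa <-]; exists a.
pose B : set (level k) := [set b | elements (setv A) (entity (Tagged level b))].
exists (inr B); rewrite -/(setv B); apply: elements_inj; [by exists l, A|by exists k, B|].
rewrite [RHS]elements_setv; apply/seteqP; split=> [y Ay|y [b Bb <-//]].
by have [b yb] := Ak _ Ay; exists b => //; rewrite /B /= -yb.
Qed.

End Superstructure.

(* Bounded quantifier formulas. Variables are numbers; BAll_in i j phi stands for
   "for all v_i in v_j, phi". The constants of a formula are the values that the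
   environment assigns to its free variables. *)
Inductive bounded_formula : Type :=
  | BMem of nat & nat
  | BEqual of nat & nat
  | BNot of bounded_formula
  | BAnd of bounded_formula & bounded_formula
  | BOr of bounded_formula & bounded_formula
  | BImplies of bounded_formula & bounded_formula
  | BAll_in of nat & nat & bounded_formula
  | BEx_in of nat & nat & bounded_formula.

Fixpoint satisfies (S : Type) (e : nat -> superstructure S)
    (phi : bounded_formula) : Prop :=
  match phi with
  | BMem i j => memv (e i) (e j)
  | BEqual i j => e i = e j
  | BNot p => ~ satisfies e p
  | BAnd p q => satisfies e p /\ satisfies e q
  | BOr p q => satisfies e p \/ satisfies e q
  | BImplies p q => satisfies e p -> satisfies e q
  | BAll_in i j p =>
      forall a, memv a (e j) -> satisfies [eta e with i |-> a] p
  | BEx_in i j p =>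
      exists a, memv a (e j) /\ satisfies [eta e with i |-> a] p
  end.

Definition internal (S S' : Type) (star : superstructure S -> superstructure S')
    (x : superstructure S') : Prop :=
  exists A : superstructure S, memv x (star A).

(* The cardinal kappa is that of the type K. *)
Definition saturated (K S S' : Type)
    (star : superstructure S -> superstructure S') : Prop :=
  forall F : set (superstructure S'),
    F `<=` [set A | is_set A /\ internal star A] ->
    F #<= [set: K] ->
    (forall G, G `<=` F -> finite_set G ->
      \bigcap_(A in G) elements A !=set0) ->
    \bigcap_(A in F) elements A !=set0.

(* starS is the set of individuals *S, the star-image of the set S, and incl is
   the inclusion of S in *S. *)
Record nonstandard_model (K S : Type) : Type := NonstandardModel {
  starS : Type;
  incl : S -> starS;
  star : superstructure S -> superstructure starS;
  incl_inj : injective incl;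
  star_base : star (set_of_ind [set: S]) = set_of_ind [set: starS];
  extension_principle : forall s : S, star (ind s) = ind (incl s);
  transfer_principle : forall (phi : bounded_formula) (e : nat -> superstructure S),
    satisfies e phi <-> satisfies (star \o e) phi;
  saturation_principle : saturated K star
}.

Section Monads.
Variables (K S : Type) (M : nonstandard_model K S).
Variables (X : topologicalType) (iX : X -> S).

(* Subsets and points of X are seen in V(S) and in *S along an inclusion iX of X
   in S. *)
Definition star_sub (G : set X) : superstructure (starS M) :=
  star M (set_of_ind (iX @` G)).

Definition standard_point (x : X) : superstructure (starS M) :=
  ind (incl M (iX x)).

Definition monad (alpha : superstructure (starS M)) :
    set (superstructure (starS M)) :=
  \bigcap_(G in [set G : set X | open G /\ memv alpha (star_sub G)])
    elements (star_sub G).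

End Monads.

Arguments star_sub {K S} M {X} iX G.
Arguments standard_point {K S} M {X} iX x.
Arguments monad {K S} M {X} iX alpha.

Definition comparable_sets (T : Type) (A B : set T) : Prop :=
  A `<=` B \/ B `<=` A.

(* Main.v *)
Require Import Defs.
From mathcomp Require Import all_boot.
From mathcomp Require Import all_classical reals.
From mathcomp Require Import topology.

Set Implicit Arguments.
Unset Strict Implicit.
Unset Printing Implicit Defensive.

Local Open Scope classical_set_scope.
Local Open Scope card_scope.

(** The inclusion of μ(x) in μ(y), for standard x and y, amounts to
    the standard condition that every open set containing y contains x. It
    follows that T0 and T1 are respectively the antisymmetry and the triviality
    of this preorder. *)

Lemma memv_set_of_ind (S : Type) (A : set S) (s : S) :
  memv (ind s) (set_of_ind A) <-> A s.
Proof.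
change (elements (@setv S 0 A) (ind s) <-> A s); rewrite elements_setv.
by split=> [[a Aa e]|As]; [rewrite -(ind_inj e)|exists s].
Qed.

(** Transfer of the atomic formula [BMem 0 1]; injectivity of [iX] then brings membership in the
    image of [G] back to [G]. *)
Lemma memv_standard_point (K S : Type) (M : nonstandard_model K S)
    (X : topologicalType) (iX : X -> S) (iX_inj : injective iX)
    (G : set X) (x : X) :
  memv (standard_point M iX x) (star_sub M iX G) <-> G x.
Proof.
pose e i := if i is 0 then ind (iX x) else set_of_ind (iX @` G).
have := transfer_principle M (BMem 0 1) e.
by rewrite /= extension_principle memv_set_of_ind image_inj // => ->.
Qed.

(** Left to right, x lies in its own monad, hence in μ(y), so in *G for every open G containing y.
    Conversely, the family of sets *G that defines μ(y) is part of the one that defines μ(x). *)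
Lemma monad_subset (K S : Type) (M : nonstandard_model K S)
    (X : topologicalType) (iX : X -> S) (iX_inj : injective iX)
    (x y : X) :
  monad M iX (standard_point M iX x) `<=` monad M iX (standard_point M iX y) <->
  forall G : set X, open G -> G y -> G x.
Proof.
split=> [xy G oG Gy|xy a ax G [oG /(memv_standard_point M iX_inj) Gy]].
  apply/(memv_standard_point M iX_inj).
  apply: xy => [H [_ Hx]|]; first exact: Hx.
  by split=> //; apply/(memv_standard_point M iX_inj).
apply: ax; split=> //; apply/(memv_standard_point M iX_inj); exact: xy.
Qed.

Lemma kolmogorov_spaceP (X : topologicalType) :
  kolmogorov_space X <->
  forall x y : X, (forall G : set X, open G -> G x <-> G y) -> x = y.
Proof.
split=> [T0 x y xy|T0 x y /eqP xNy].
  (* The separating set [A] is only a neighbourhood; its interior is open and still contains the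
     point, so [xy] carries it to the other point. *)
  apply/eqP/negPn/negP => /T0[A [[]|[]]]; rewrite !inE => /nbhs_interior Az;
    apply; apply: interior_subset; apply/(xy _ (open_interior A));
    exact: nbhs_singleton.
apply: contrapT => noG; apply: xNy; apply: T0 => G oG.
split=> [Gx|Gy]; apply: contrapT => nG; apply: noG; exists G; [left|right];
  by rewrite !inE; split; [exact: open_nbhs_nbhs|].
Qed.

Lemma accessible_spaceP (X : topologicalType) :
  accessible_space X <->
  forall x y : X, (forall G : set X, open G -> G y -> G x) -> x = y.
Proof.
split=> [T1 x y xy|T1 x y /eqP xNy].
  (* The swap makes [A] contain y and miss x, the side on which the one-sided hypothesis applies. *)
  apply/eqP/negPn/negP; rewrite eq_sym => /T1[A [oA]].
  by rewrite !inE => Ay; apply; exact: xy.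
apply: contrapT => noG; apply: xNy; apply/esym/T1 => G oG Gx.
apply: contrapT => nGy; by apply: noG; exists G; rewrite !inE.
Qed.

Theorem mainTheorem10 (R : realType) (X : topologicalType)
    (S : Type) (iR : R -> S) (iX : X -> S)
    (iR_inj : injective iR) (iX_inj : injective iX)
    (K : Type) (K_infinite : infinite_set [set: K])
    (T_le_K : [set G : set X | open G] #<= [set: K])
    (K_nle_T : ~ ([set: K] #<= [set G : set X | open G]))
    (M : nonstandard_model K S) :
  (kolmogorov_space X <->
     forall x y : X,
       x = y <->
       monad M iX (standard_point M iX x) = monad M iX (standard_point M iX y))
  /\
  (accessible_space X <->
     forall x y : X,
       x = y <->
       comparable_sets (monad M iX (standard_point M iX x))
                       (monad M iX (standard_point M iX y))).
Proof.
split.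
  rewrite kolmogorov_spaceP; split=> [T0 x y|T0 x y xy].
    split=> [->//|/seteqP[/(monad_subset M iX_inj) xy /(monad_subset M iX_inj) yx]].
    by apply: T0 => G oG; split; [exact: yx|exact: xy].
  by apply/T0/seteqP; split; apply/(monad_subset M iX_inj) => G oG /(xy _ oG).
rewrite accessible_spaceP; split=> [T1 x y|T1 x y xy].
  (* The T1 criterion is one-sided, so whichever inclusion holds already forces equality. *)
  split=> [->|[/(monad_subset M iX_inj) xy|/(monad_subset M iX_inj) yx]].
  - by left.
  - exact: T1.
  - exact/esym/T1.
(* The one-sided condition gives one inclusion, which is enough for comparability. *)
by apply/T1; left; apply/(monad_subset M iX_inj).
Qed.
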